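(* Let $n\ge 1$. The set of signed permutations in $S^{\mathrm{B}}_n$ that globally avoid the patterns $231$, $312$, and $321$ is equal to the set of free signed permutations in $S^{\mathrm{B}}_n$. In other words, being free is a persistent property.
   Context: Notation: $[n]=\{1,\dots,n\}$ and $[\pm n]=\{\pm1,\dots,\pm n\}$. Elements of the symmetric group $S_k$ are written in one-line notation $p(1)\cdots p(k)$. A signed permutation of size $n$ is a bijection $w:[\pm n]\to[\pm n]$ with $w(-x)=-w(x)$ for all $x\in[n]$. The group of these under composition is $S^{\mathrm{B}}_n$, the finite Coxeter group of type B, with simple generators $s_0,s_1,\dots,s_{n-1}$, where $s_0$ exchanges $1$ and $-1$ and fixes all other elements of $[\pm n]$, and, for $1\le i\le n-1$, $s_i$ exchanges $i$ with $i+1$ and $-i$ with $-(i+1)$ and fixes all other elements. The symmetric group $S_n$ is the Coxeter group of type A, with the adjacent transpositions as simple generators. Free: an element of $S_n$ or of $S^{\mathrm{B}}_n$ is free if, in its reduced decompositions (shortest expressions as products of simple generators), all generators that appear commute with each other. Classical avoidance in $S_n$: for $p\in S_k$, a permutation $w\in S_n$ contains $p$ if there are indices $1\le i_1<\cdots<i_k\le n$ such that $w(i_1)\cdots w(i_k)$ is order-isomorphic to $p$; otherwise $w$ avoids $p$. Global avoidance: for $p\in S_k$, a signed permutation $w\in S^{\mathrm{B}}_n$ globally contains $p$ if there are indices $i_1<\cdots<i_k$ in $[\pm n]$ (in the usual order of the integers) such that $w(i_1)\cdots w(i_k)$ is order-isomorphic to $p$; otherwise $w$ globally avoids $p$. Persistent: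 let $\phi$ be a property defined for elements of $S_n$ and of $S^{\mathrm{B}}_n$ such that the permutations in $S_n$ with property $\phi$ are exactly those avoiding all patterns in a set $A_\phi$ of (unsigned) permutations. The property $\phi$ is persistent if the signed permutations in $S^{\mathrm{B}}_n$ with property $\phi$ are exactly those globally avoiding all patterns in $A_\phi$. It is a known result that a permutation in $S_n$ is free if and only if it avoids $231$, $312$, and $321$. *)

(* Defs.v *)
From HB Require Import structures.
From mathcomp Require Import all_boot all_order all_algebra all_fingroup.
Set Implicit Arguments.
Unset Strict Implicit.
Unset Printing Implicit Defensive.
Import Order.TTheory GRing.Theory Num.Theory.
Local Open Scope group_scope.

(* Products of permutations are MathComp's, (s * t) x = t (s x), i.e. the
   opposite of the usual composition.  This only reverses the decompositions of
   an element, so it affects neither which of them are reduced nor which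
   generators they involve. *)

Section Free.
Variables (gT : finGroupType) (S : {set gT}).

Definition decomposition (w : gT) (u : seq gT) : Prop :=
  {subset u <= S} /\ \prod_(s <- u) s = w.

Definition reduced (w : gT) (u : seq gT) : Prop :=
  decomposition w u /\ forall v, decomposition w v -> (size u <= size v)%N.

Definition is_free (w : gT) : Prop :=
  forall u, reduced w u -> {in u &, forall s t, commute s t}.

End Free.

Definition simpleA (n : nat) : {set 'S_n} :=
  [set tperm i j | i : 'I_n, j : 'I_n in [pred j : 'I_n | j == i.+1 :> nat]].

(* [+-n]: (false, i) stands for i + 1 and (true, i) for - (i + 1); the order on
   it is that of the integers, through [pmval]. *)
Definition pm (n : nat) : finType := (bool * 'I_n)%type.
Definition pos (n : nat) (i : 'I_n) : pm n := (false, i).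
Definition opp (n : nat) (x : pm n) : pm n := (~~ x.1, x.2).
Definition pmval (n : nat) (x : pm n) : int :=
  if x.1 then (- x.2.+1%:Z)%R else x.2.+1%:Z%R.

Definition SB (n : nat) : {set {perm pm n}} :=
  [set w : {perm pm n} | [forall i, w (opp (pos i)) == opp (w (pos i))]].

Lemma oppK n : involutive (@opp n).
Proof. by case=> b i; rewrite /opp /= negbK. Qed.

Lemma pmval_opp n (x : pm n) : pmval (opp x) = (- pmval x)%R.
Proof. by case: x => [[] i]; rewrite /pmval /= ?opprK. Qed.

Lemma pmval_inj n : injective (@pmval n).
Proof.
by move=> [[] i] [[] j]; rewrite /pmval //= => -[] /val_inj ->.
Qed.

Lemma SBP n (w : {perm pm n}) :
  reflect (forall x, w (opp x) = opp (w x)) (w \in SB n).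
Proof.
rewrite inE; apply: (iffP forallP) => [H x | H i]; last by apply/eqP/H.
case: x => [[] i]; have /eqP := H i => //.
by rewrite /opp /pos /= => ->; rewrite /= negbK; case: (w _).
Qed.

Lemma SB_group_set n : group_set (SB n).
Proof.
apply/group_setP; split=> [|v w /SBP Hv /SBP Hw].
  by apply/SBP => x; rewrite !perm1.
by apply/SBP => x; rewrite !permM Hv Hw.
Qed.
Canonical SB_group n := Group (SB_group_set n).

Definition simpleB (n : nat) : {set {perm pm n}} :=
  [set tperm (pos i) (opp (pos i)) | i : 'I_n & (i == 0%N :> nat)] :|:
  [set tperm (pos i) (pos j) * tperm (opp (pos i)) (opp (pos j))
     | i : 'I_n, j : 'I_n in [pred j : 'I_n | j == i.+1 :> nat]].

Definition contains (k n : nat) (p : 'S_k) (w : 'S_n) : Prop :=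
  exists2 f : 'I_k -> 'I_n,
    (forall a b : 'I_k, (a < b)%N -> (f a < f b)%N) &
    (forall a b : 'I_k, (w (f a) < w (f b))%N = (p a < p b)%N).

Definition globally_contains (k n : nat) (p : 'S_k) (w : {perm pm n}) : Prop :=
  exists2 f : 'I_k -> pm n,
    (forall a b : 'I_k, (a < b)%N -> (pmval (f a) < pmval (f b))%R) &
    (forall a b : 'I_k, (pmval (w (f a)) < pmval (w (f b)))%R = (p a < p b)%N).

Definition pattern_set : Type := forall k : nat, 'S_k -> Prop.

Definition avoids_all (A : pattern_set) (n : nat) (w : 'S_n) : Prop :=
  forall (k : nat) (p : 'S_k), A k p -> ~ contains p w.

Definition globally_avoids_all
    (A : pattern_set) (n : nat) (w : {perm pm n}) : Prop :=
  forall (k : nat) (p : 'S_k), A k p -> ~ globally_contains p w.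

(* A property of elements of the S_n and of the signed permutation groups is
   given by its two families of restrictions; [phiB] matters only on [SB n]. *)
Definition persistent (phiA : forall n, 'S_n -> Prop)
    (phiB : forall n, {perm pm n} -> Prop) : Prop :=
  exists A : pattern_set,
    (forall n, (1 <= n)%N -> forall w : 'S_n, phiA n w <-> avoids_all A w) /\
    (forall n, (1 <= n)%N -> forall w : {perm pm n}, w \in SB n ->
       (phiB n w <-> globally_avoids_all A w)).

Definition one_line (k : nat) (p : 'S_k) : seq nat :=
  [seq (p i).+1 | i <- enum 'I_k].

Definition patterns_231_312_321 : pattern_set := fun k p =>
  (one_line p \in [:: [:: 2; 3; 1]; [:: 3; 1; 2]; [:: 3; 2; 1]])%N.

(* Main.v *)
Require Import Defs.
From HB Require Import structures.
From mathcomp Require Import all_boot all_order all_algebra all_fingroup.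
From mathcomp Require Import zify.
(* In both types, rank the permuted elements by position.  A permutation avoids
   231, 312 and 321 exactly when it moves every rank by at most one, i.e. when
   it is a product of disjoint adjacent transpositions: if [x] goes up by two
   or more, at least two later elements have smaller images.
   A product of commuting simple generators moves ranks by at most one.
   Conversely, if [w] does so, it is the product of the set J of the generators
   agreeing with it, which commute; every word for [w] must contain each
   element of J, so the reduced words are exactly the orderings of J. *)

Set Implicit Arguments.
Unset Strict Implicit.
Unset Printing Implicit Defensive.
Local Open Scope group_scope.

(** * Permutations moving every rank by at most one *)

Section Ranked.
Variables (T : finType) (rk : T -> nat).
Hypothesis rk_inj : injective rk.
Hypothesis rk_lt : forall x, (rk x < #|T|)%N.
Implicit Types (w : {perm T}) (x y z : T).

Definition near w :=
  forall x, (rk (w x) <= (rk x).+1)%N /\ (rk x <= (rk (w x)).+1)%N.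

Lemma nearV w : near w -> near w^-1.
Proof. by move=> wN x; have := wN (w^-1 x); rewrite permKV => -[]. Qed.

Lemma unrank r : (r < #|T|)%N -> exists x, rk x = r.
Proof.
move=> r_lt; pose f x := Ordinal (rk_lt x).
have f_inj : injective f by move=> x y /(congr1 val) /rk_inj.
have /codomP[x Ex] : Ordinal r_lt \in codom f.
  by apply: inj_card_onto; rewrite ?card_ord.
by exists x; have /(congr1 val) := Ex.
Qed.

Lemma card_rk_lt x : #|[set z | (rk z < rk x)%N]| = rk x.
Proof.
rewrite cardE -(size_map rk) -[RHS](size_iota 0).
apply/perm_size/uniq_perm; rewrite ?iota_uniq ?(map_inj_uniq rk_inj)
  ?enum_uniq //.
move=> r; rewrite mem_iota /=; apply/mapP/idP => [[z]|lt_r].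
  by rewrite mem_enum inE => ? ->.
have [z Ez] := unrank (ltn_trans lt_r (rk_lt x)).
by exists z; rewrite // mem_enum inE Ez.
Qed.

Lemma card_perm_rk_lt w x : #|[set z | (rk (w z) < rk (w x))%N]| = rk (w x).
Proof.
rewrite -[RHS]card_rk_lt -(card_imset _ (@perm_inj _ w)); apply: eq_card => z.
apply/imsetP/idP => [[y]|]; first by rewrite !inE => ? ->.
by rewrite inE => lt_z; exists (w^-1 z); rewrite ?inE permKV.
Qed.

(** As many elements have their image below [w x] as lie below [w x] themselves. The second set
    contains [x] and the first does not, so some [y] at or above [w x] has its image below [w x];
    nearness leaves only [y = w x], with image [x]. *)
Lemma near_swap_up w x : near w -> rk (w x) = (rk x).+1 -> w (w x) = x.
Proof.
move=> wN Ewx.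
pose A := [set z | (rk (w z) < rk (w x))%N].
pose B := [set z | (rk z < rk (w x))%N].
have cAB : #|A| = #|B| by rewrite card_perm_rk_lt card_rk_lt.
have /subsetPn[y] : ~~ (A \subset B).
  apply/negP => sAB; have /setP/(_ x) : A = B.
    by apply/eqP; rewrite eqEcard sAB cAB /=.
  by rewrite !inE ltnn Ewx ltnSn.
rewrite !inE => yA yB; have [wy1 wy2] := wN y.
have -> : w x = y by apply: rk_inj; lia.
by apply: rk_inj; lia.
Qed.

Lemma near_invol w x : near w -> w (w x) = x.
Proof.
move=> wN; have [wx1 wx2] := wN x.
have [/rk_inj Ex|[Ex|Ex]] :
    rk (w x) = rk x \/ rk (w x) = (rk x).+1 \/ rk x = (rk (w x)).+1 by lia.
- by rewrite !Ex.
- exact: near_swap_up.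
(* If [w] lowers [x], then [w^-1] raises [w x]'s preimage pattern in reverse: it sends [w x] up to
   [x], and the previous case applies to it. *)
apply: (perm_inj (s := w^-1)); rewrite permK.
by have := near_swap_up (nearV wN) (x := w x); rewrite permK => ->.
Qed.

(* Permuting by two commuting near involutions moves a point two steps only if
   both send it to the same neighbour, in which case the point is fixed. *)
Lemma near_mul s t :
  near s -> near t -> commute s t -> near (s * t).
Proof.
move=> sN tN cst x; rewrite permM.
have [s1 s2] := sN x; have [t1 t2] := tN (s x).
have [t3 t4] := tN x; have [s3 s4] := sN (t (s x)).
have Et : s (t (s x)) = t x.
  by rewrite -!permM -cst mulgA !permM near_invol.
rewrite Et in s3 s4.
have tt : t (t x) = x by apply: near_invol.
case: (eqVneq (rk (t x)) (rk (s x))) => [/rk_inj E|/eqP]; last by lia.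
by rewrite -E tt; lia.
Qed.

Lemma near_prod (u : seq {perm T}) :
  (forall s, s \in u -> near s) -> {in u &, forall s t, commute s t} ->
  near (\prod_(s <- u) s).
Proof.
elim: u => [|s u IHu] uN uC; first by rewrite big_nil => x; rewrite perm1; lia.
rewrite big_cons; apply: near_mul.
- by apply: uN; rewrite mem_head.
- apply: IHu => [t t_u|t t' t_u t'_u]; first by apply: uN; rewrite inE t_u orbT.
  by apply: uC; rewrite inE ?t_u ?t'_u orbT.
rewrite big_seq; elim/big_rec: _ => [|t v t_u]; first exact: commute1.
by apply: commuteM; apply: uC; rewrite inE ?t_u ?eqxx ?orbT.
Qed.

(** Both patterns begin with their largest value; the order of the other two is left open. *)
Definition has_312_or_321 w := exists x y z,
  [/\ (rk x < rk y < rk z)%N, (rk (w y) < rk (w x))%N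
    & (rk (w z) < rk (w x))%N].

(** There are [rk (w x)] elements with an image below [w x], and at most [rk x] of them precede [x],
    so at least two follow it. *)
Lemma rise_312_or_321 w x : ((rk x).+1 < rk (w x))%N -> has_312_or_321 w.
Proof.
move=> lt_wx.
pose A := [set z | (rk (w z) < rk (w x))%N].
pose B := [set z | (rk z < rk x)%N].
have : (1 < #|A :\: B|)%N.
  have := card_perm_rk_lt w x; have := card_rk_lt x; rewrite -/A -/B.
  have := cardsID B A; have := subset_leq_card (subsetIr A B); lia.
have xP y : y \in A :\: B -> (rk x < rk y)%N /\ (rk (w y) < rk (w x))%N.
  rewrite !inE -leqNgt leq_eqVlt => /andP[/orP[/eqP/rk_inj ->|//]].
  by rewrite ltnn.
case/card_gt1P=> y [z [/xP[xy wyx] /xP[xz wzx] yz]].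
wlog lt_yz : y z xy wyx xz wzx yz / (rk y < rk z)%N.
  move=> H; case: (ltngtP (rk y) (rk z)) => [/H|/H|/rk_inj E]; first exact.
    by apply=> //; rewrite eq_sym.
  by rewrite E eqxx in yz.
by exists x, y, z; split; rewrite ?xy.
Qed.

(** The inverse handles the elements that [w] lowers, since it raises their images by as much.
    Conversely, [x] and [z] are two ranks apart, and steps of at most one cannot invert them. *)
Lemma near_312_or_321 w : near w <-> ~ has_312_or_321 w /\ ~ has_312_or_321 w^-1.
Proof.
have drop v : near v -> ~ has_312_or_321 v.
  move=> vN [x [y [z [? ? ?]]]].
  by have := vN x; have := vN y; have := vN z; lia.
split=> [wN|[H1 H2] x]; first by split; apply: drop => //; apply: nearV.
split; rewrite leqNgt; apply/negP => lt_x; first by apply/H1/rise_312_or_321/lt_x.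
by apply: H2; apply: (@rise_312_or_321 _ (w x)); rewrite permK.
Qed.

Definition rk_contains k (p : 'S_k) w := exists2 f : 'I_k -> T,
  (forall a b : 'I_k, (a < b)%N -> (rk (f a) < rk (f b))%N) &
  (forall a b : 'I_k, (rk (w (f a)) < rk (w (f b)))%N = (p a < p b)%N).

Definition avoids3 w := forall k (p : 'S_k),
  patterns_231_312_321 p -> ~ rk_contains p w.

End Ranked.

(** * Avoidance of the three patterns, in terms of ranks *)

Lemma one_line3 (p : 'S_3) :
  one_line p = [:: (p ord0).+1; (p (lift ord0 ord0)).+1; (p ord_max).+1].
Proof.
rewrite /one_line !enum_ordSl /= (_ : enum 'I_0 = [::]) //=.
  by congr [:: _; _; (p _).+1]; apply: val_inj.
by apply: size0nil; rewrite size_enum_ord.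
Qed.

Lemma perm_of_values n (v : seq nat) :
  perm_eq v (iota 0 n) -> exists p : 'S_n, forall i, p i = nth 0%N v i :> nat.
Proof.
move=> vP; have sz_v : size v = n by rewrite (perm_size vP) size_iota.
have v_lt (i : 'I_n) : (nth 0%N v i < n)%N.
  have : nth 0%N v i \in iota 0 n by rewrite -(perm_mem vP) mem_nth ?sz_v.
  by rewrite mem_iota.
have p_inj : injective (fun i => Ordinal (v_lt i)).
  move=> i j /(congr1 val) /= /eqP; rewrite nth_uniq ?sz_v //.
    by move/eqP/val_inj.
  by rewrite (perm_uniq vP) iota_uniq.
by exists (perm p_inj) => i; rewrite permE.
Qed.

Section RankedAvoidance.
Variables (T : finType) (rk : T -> nat).
Hypothesis rk_inj : injective rk.
Hypothesis rk_lt : forall x, (rk x < #|T|)%N.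
Implicit Types (w : {perm T}) (x y z : T).

(** The pattern has the values [a], [b], [c], counted from 0. Three comparisons suffice, because
    distinct elements have distinct images. *)
Lemma not_avoids3 w x y z a b c :
  (rk x < rk y < rk z)%N ->
  [:: a.+1; b.+1; c.+1] \in
    [:: [:: 2; 3; 1]; [:: 3; 1; 2]; [:: 3; 2; 1]]%N ->
  [/\ (rk (w x) < rk (w y))%N = (a < b)%N,
      (rk (w x) < rk (w z))%N = (a < c)%N
    & (rk (w y) < rk (w z))%N = (b < c)%N] ->
  ~ avoids3 rk w.
Proof.
move=> /andP[xy yz] vP [wxy wxz wyz].
have ne t t' : rk t != rk t' -> rk (w t) != rk (w t').
  by rewrite !(inj_eq rk_inj) (inj_eq perm_inj).
have := ne x y; have := ne y z; have := ne x z => nxz nyz nxy.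
have v_iota : perm_eq [:: a; b; c] (iota 0 3).
  by move: vP; rewrite !inE => /or3P[] /eqP[-> -> ->].
have [p pE] := perm_of_values v_iota.
move=> /(_ 3%N p); case.
  by rewrite /patterns_231_312_321 one_line3 !pE.
have : uniq [:: a; b; c] by rewrite (perm_uniq v_iota).
rewrite /= !inE => abc.
exists (fun i : 'I_3 => nth x [:: x; y; z] i) => i j.
  by case: i j => [[|[|[|]]] ? //] [[|[|[|]]] ? //] //=; lia.
rewrite !pE; case: i j => [[|[|[|]]] ? //] [[|[|[|]]] ? //] /=; lia.
Qed.

Lemma avoids3P w : avoids3 rk w <-> near rk w.
Proof.
split=> [avw | wN k p pP [f f_mono f_iso]].
  apply/(near_312_or_321 rk_inj rk_lt); split=> [[x [y [z [xyz wyx wzx]]]] | ].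
    case: (ltnP (rk (w y)) (rk (w z))) => wyz.
      by apply: (not_avoids3 (a := 2) (b := 0) (c := 1) xyz _ _ avw) => //;
        split=> /=; lia.
    by apply: (not_avoids3 (a := 2) (b := 1) (c := 0) xyz _ _ avw) => //;
        split=> /=; lia.
  move=> [x [y [z [xyz]]]].
  (* Here [x], [y], [z] are values of [w], at the positions [a], [b], [c]; a 312 or 321 of [w^-1]
     reads as a 231 or 321 of [w]. *)
  set a := w^-1 x; set b := w^-1 y; set c := w^-1 z => ba ca.
  have [Ea Eb Ec] : [/\ w a = x, w b = y & w c = z] by rewrite !permKV.
  case: (ltngtP (rk b) (rk c)) => [bc|cb|/rk_inj E].
  - have bca : (rk b < rk c < rk a)%N by lia.
    apply: (not_avoids3 (a := 1) (b := 2) (c := 0) bca _ _ avw) => //.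
    by rewrite Ea Eb Ec; split=> /=; lia.
  - have cba : (rk c < rk b < rk a)%N by lia.
    apply: (not_avoids3 (a := 2) (b := 1) (c := 0) cba _ _ avw) => //.
    by rewrite Ea Eb Ec; split=> /=; lia.
  by have := congr1 rk Ec; rewrite -E Eb; lia.
have k3 : k = 3%N.
  have sz_p : size (one_line p) = k by rewrite size_map size_enum_ord.
  rewrite -[LHS]sz_p.
  by move: pP; rewrite /patterns_231_312_321 !inE => /or3P[] /eqP->.
subst k; move: pP; rewrite /patterns_231_312_321 one_line3.
set i0 : 'I_3 := ord0; set i1 : 'I_3 := lift _ _.
set i2 : 'I_3 := ord_max => pP.
have := f_mono i0 i1 isT; have := f_mono i1 i2 isT.
have := f_iso i0 i1; have := f_iso i1 i2; have := f_iso i0 i2.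
have := f_iso i1 i0; have := f_iso i2 i1; have := f_iso i2 i0.
have := wN (f i0); have := wN (f i1); have := wN (f i2).
(* In all three patterns the first value exceeds the last, while their positions are at least two
   ranks apart. *)
by move: pP; rewrite !inE => /or3P[] /eqP[-> -> ->] /=; lia.
Qed.

End RankedAvoidance.

(** * Generators acting as adjacent transpositions, up to a symmetry *)

Section FoldedTranspositions.
Variables (T : finType) (rk : T -> nat) (C : nat).
Variables (G : {group {perm T}}) (S : {set {perm T}}).
Hypothesis rk_inj : injective rk.
Hypothesis rk_lt : forall x, (rk x < #|T|)%N.
Hypothesis sSG : S \subset G.
Hypothesis S_near : forall s, s \in S -> near rk s.
Hypothesis S_adjacent : forall x y,
  rk y = (rk x).+1 -> exists2 s, s \in S & s x = y.
(* For signed permutations, [C] is the sum of the ranks of two opposite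
   elements, and a generator swapping [x] with [s x] also swaps their
   opposites. *)
Hypothesis S_ascents : forall s x z, s \in S ->
  (rk x < rk (s x))%N -> (rk z < rk (s z))%N ->
  z = x \/ forall w, w \in G ->
    rk (w z) + rk (w (s x)) = C /\ rk (w (s z)) + rk (w x) = C.
Implicit Types (s t w : {perm T}) (x y z : T).

Lemma S_invol s x : s \in S -> s (s x) = x.
Proof. by move=> /S_near; apply: near_invol. Qed.

(** [S_ascents] carries the agreement from one point raised by [s] to any other, and points lowered
    by [s] follow because [s] and [w] are involutions. *)
Lemma S_agree w s x : w \in G -> near rk w -> s \in S ->
  s x != x -> w x = s x -> forall y, s y != y -> w y = s y.
Proof.
move=> wG wN sS.
have asc x' y : (rk x' < rk (s x'))%N -> (rk y < rk (s y))%N ->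
    w x' = s x' -> w y = s y.
  move=> ltx lty Ewx; case: (S_ascents sS ltx lty) => [-> // | EC].
  (* Since [w (s x') = x'], the relations for [w] and for the identity say that [rk (w y)] and
     [rk (s y)] both complete [rk x'] to [C]. *)
  have [C1 _] := EC _ wG; have := EC _ (group1 G); rewrite !perm1 => -[_ C2].
  apply: rk_inj; move: C1; rewrite -Ewx (near_invol rk_inj rk_lt) //; lia.
have flip x' : s x' != x' -> w x' = s x' -> exists2 x'',
    (rk x'' < rk (s x''))%N & w x'' = s x''.
  rewrite -(inj_eq rk_inj) => nx Ewx.
  case: (ltngtP (rk x') (rk (s x'))) nx => // lt _.
    by exists x'.
  exists (s x'); first by rewrite S_invol.
  by rewrite -Ewx (near_invol rk_inj rk_lt) // Ewx S_invol.
move=> nx /(flip _ nx)[x' ltx' Ewx'] y.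
rewrite -(inj_eq rk_inj) => ny; case: (ltngtP (rk y) (rk (s y))) ny => // lt _.
  exact: asc Ewx'.
have Ew : w (s y) = y by rewrite (asc _ _ ltx' _ Ewx') S_invol.
by rewrite -{1}Ew (near_invol rk_inj rk_lt).
Qed.

Lemma S_eq s t x : s \in S -> t \in S -> s x != x -> s x = t x -> s = t.
Proof.
move=> sS tS nx E; apply/permP => y.
have [sG tG] := (subsetP sSG s sS, subsetP sSG t tS).
case: (eqVneq (s y) y) => [Es|ns]; last first.
  by rewrite (S_agree tG (S_near tS) sS nx (esym E) ns).
case: (eqVneq (t y) y) => [-> //|nt].
by apply: (S_agree sG (S_near sS) tS _ E nt); rewrite -E.
Qed.

(** * Existence of words, by sorting under a growing weight *)

Definition weight w := (\sum_x rk x * rk (w x))%N.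

(* Twice the increase of the weight is the sum over [x] of
   [(rk (s x) - rk x) * (rk (w x) - rk (w (s x)))]. *)
Lemma weight_lt w s x : w \in G -> s \in S ->
  (rk x < rk (s x))%N -> (rk (w (s x)) < rk (w x))%N ->
  (weight w < weight (s * w))%N.
Proof.
move=> wG sS ltx ltwx.
have drop z : (rk z < rk (s z))%N -> (rk (w (s z)) < rk (w z))%N.
  move=> ltz; case: (S_ascents sS ltx ltz) => [-> // | EC].
  have [? ?] := EC _ wG; lia.
have E1 : weight w = (\sum_z rk (s z) * rk (w (s z)))%N.
  exact: (reindex_inj (@perm_inj _ s)).
have E2 : weight (s * w) = (\sum_z rk z * rk (w (s z)))%N.
  by apply: eq_bigr => z _; rewrite permM.
have E3 : weight (s * w) = (\sum_z rk (s z) * rk (w z))%N.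
  rewrite E2 (reindex_inj (@perm_inj _ s)).
  by apply: eq_bigr => z _; rewrite S_invol.
suff : (weight w + weight w < weight (s * w) + weight (s * w))%N by lia.
rewrite {2}E1 {1}E2 E3 -!big_split /=.
(* The summand at [x] gives strictness; the others only need a weak inequality. *)
rewrite (bigD1 x) //= [X in (_ < X)%N](bigD1 x) //=.
rewrite -addSn leq_add //; first by nia.
apply: leq_sum => z _; case: (ltngtP (rk z) (rk (s z))) => [lt|lt|E].
- by have := drop z lt; nia.
- by have := drop (s z); rewrite S_invol // => /(_ lt); nia.
by rewrite E; lia.
Qed.

(** If images of neighbours always increase, [w] lowers no rank, nor does any power of [w]. As
    [w^-1] is such a power, [w] raises no rank either. *)
Lemma descent w : w != 1 -> exists x y,
  rk y = (rk x).+1 /\ (rk (w y) < rk (w x))%N.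
Proof.
move=> w1.
pose ok := [forall x, forall y,
  (rk y == (rk x).+1) ==> (rk (w x) < rk (w y))%N].
have [/forallP okw|] := boolP ok; last first.
  case/forallPn => x /forallPn[y]; rewrite negb_imply -leqNgt.
  move=> /andP[/eqP Exy le].
  exists x, y; split=> //; rewrite ltn_neqAle le (inj_eq rk_inj).
  rewrite (inj_eq perm_inj) -(inj_eq rk_inj) Exy.
  by rewrite andbT neq_ltn ltnSn orbT.
case/eqP: w1; apply/permP => z; rewrite perm1; apply: rk_inj; apply/eqP.
have up n x : rk x = n -> (n <= rk (w x))%N.
  elim: n x => // n IHn x Ex.
  have [|y Ey] := unrank rk_inj rk_lt (r := n).
    by rewrite (ltn_trans _ (rk_lt x)) ?Ex.
  have /forallP/(_ x)/implyP := okw y; rewrite Ex Ey eqxx => /(_ isT).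
  by apply: leq_trans; rewrite ltnS IHn.
have up_pow n x : (rk x <= rk ((w ^+ n) x))%N.
  elim: n => [|n IHn]; first by rewrite expg0 perm1.
  by rewrite expgSr permM (leq_trans IHn) ?(up _ _ (erefl _)).
rewrite eqn_leq (up _ _ (erefl _)) andbT.
by have := up_pow #[w].-1 (w z); rewrite -invg_expg permK.
Qed.


Lemma weight_le w : (weight w <= #|T| * (#|T| * #|T|))%N.
Proof.
rewrite -sum_nat_const; apply: leq_sum => x _.
by rewrite leq_mul // ltnW ?rk_lt.
Qed.

(** Induction on the gap between the weight and its bound: a generator [s] exchanging the two
    elements of a descent makes [s * w] heavier, and [s] is put in front of a word for [s * w]. *)
Lemma ex_decomposition w : w \in G -> exists u, decomposition S w u.
Proof.
have [n] := ubnP (#|T| * (#|T| * #|T|) - weight w)%N.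
elim: n w => // n IHn w lt_n wG.
have [->|w1] := eqVneq w 1; first by exists [::]; split; rewrite ?big_nil.
have [x [y [Exy ltw]]] := descent w1.
have [s sS Es] := S_adjacent Exy.
have ltx : (rk x < rk (s x))%N by rewrite Es; lia.
have sG : s \in G := subsetP sSG s sS.
have [u [uS Eu]] : exists u, decomposition S (s * w) u.
  apply: IHn; last exact: groupM.
  rewrite -Es in ltw; have := weight_lt wG sS ltx ltw.
  have := weight_le (s * w); move: lt_n; set N := (#|T| * _)%N.
  by move: (weight _) (weight _) => a b; lia.
exists (s :: u); split=> [t|]; first by rewrite inE => /predU1P[-> // | /uS].
rewrite big_cons Eu mulgA -[RHS]mul1g; congr (_ * _).
by apply/permP => z; rewrite permM perm1 S_invol.
Qed.

(** Freeness speaks of all reduced words, so deducing anything from it takes one such word. *)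
Lemma ex_reduced w : w \in G -> exists u, reduced S w u.
Proof.
move=> wG; have [u0 [u0S Eu0]] := ex_decomposition wG.
(* Tuples of fixed length form a finite type, which makes [P] boolean, as [ex_minnP] demands. *)
pose P n := [exists u : n.-tuple {perm T},
  all (mem S) u && (\prod_(s <- u) s == w)].
have PP n : reflect (exists2 u, decomposition S w u & size u = n) (P n).
  apply: (iffP existsP) => [[u /andP[/allP uS /eqP Eu]]|[u [uS Eu] sz]].
    by exists u; rewrite ?size_tuple.
  rewrite -sz; exists (in_tuple u); rewrite Eu eqxx andbT; exact/allP.
have exP : exists n, P n by exists (size u0); apply/PP; exists u0.
case: (ex_minnP exP) => n /PP[u uw sz] min_n; exists u; split=> // v vw.
by rewrite sz min_n //; apply/PP; exists v.
Qed.

(** * The generators agreeing with a near element *)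

Definition agreeing w := [set s in S | [exists x, (s x != x) && (w x == s x)]].

Section Near.
Variable w : {perm T}.
Hypotheses (wG : w \in G) (wN : near rk w).

Lemma agreeingP s : s \in agreeing w ->
  s \in S /\ forall x, s x != x -> w x = s x.
Proof.
rewrite inE => /andP[sS /existsP[x /andP[nx /eqP Ex]]]; split=> //.
exact: S_agree Ex.
Qed.

(** At a common moved point both generators take the value of [w], so [S_eq] applies. Distinct
    elements of [agreeing w] thus have disjoint supports. *)
Lemma agreeing_eq s t x : s \in agreeing w -> t \in agreeing w ->
  s x != x -> t x != x -> s = t.
Proof.
move=> /agreeingP[sS Es] /agreeingP[tS Et] ns nt.
by apply: (S_eq sS tS ns); rewrite -Es // -Et.
Qed.

Lemma agreeing_commute s t :
  s \in agreeing w -> t \in agreeing w -> commute s t.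
Proof.
move=> sJ tJ; apply/permP => x; rewrite !permM.
have [[sS _] [tS _]] := (agreeingP sJ, agreeingP tJ).
have inj_ne (v : {perm T}) z : v z != z -> v (v z) != v z.
  by rewrite (inj_eq perm_inj).
have [Es|ns] := eqVneq (s x) x; have [Et|nt] := eqVneq (t x) x.
- by rewrite Es Et Es.
- rewrite Es; have [-> //|nst] := eqVneq (s (t x)) (t x).
  by case/eqP: (nt); rewrite -(agreeing_eq sJ tJ nst (inj_ne _ _ nt)).
- rewrite Et; have [-> //|nst] := eqVneq (t (s x)) (s x).
  by case/eqP: (ns); rewrite -(agreeing_eq tJ sJ nst (inj_ne _ _ ns)).
by rewrite (agreeing_eq sJ tJ ns nt).
Qed.

Lemma prod_agreeing : \prod_(s <- enum (agreeing w)) s = w.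
Proof.
(* By disjointness at most one factor moves a given point, and it does so as [w] does. *)
have prodE v x : uniq v -> {subset v <= agreeing w} ->
    (\prod_(s <- v) s) x = if has (fun s => s x != x) v then w x else x.
  elim: v x => [|s v IHv] x /=; first by rewrite big_nil perm1.
  move=> /andP[s_v v_uniq] sub; rewrite big_cons permM.
  have sJ : s \in agreeing w by rewrite sub ?mem_head.
  have vJ : {subset v <= agreeing w}.
    by move=> t t_v; rewrite sub ?inE ?t_v ?orbT.
  rewrite IHv //; have [Es|ns] := eqVneq (s x) x; first by rewrite Es.
  have [_ /(_ x ns) -> /=] := agreeingP sJ.
  case: hasP => [[t t_v nt]|//]; case/negP: s_v.
  by rewrite (agreeing_eq sJ (vJ _ t_v) (x := s x)) // (inj_eq perm_inj).
apply/permP => x; rewrite prodE ?enum_uniq //; last first.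
  by move=> s; rewrite mem_enum.
case: ifP => // /negbT/hasPn noJ; apply/eqP/negPn/negP; rewrite eq_sym => nx.
(* A point moved by [w] goes to a neighbour, and some generator exchanges the two. *)
have [s sS Es] : exists2 s, s \in S & s x = w x.
  have [w1 w2] := wN x; move: nx; rewrite -(inj_eq rk_inj) => nx.
  have [E|E] : rk (w x) = (rk x).+1 \/ rk x = (rk (w x)).+1 by lia.
    exact: S_adjacent.
  have [s sS Es] := S_adjacent E; exists s => //.
  by rewrite -[x in LHS]Es S_invol.
have /noJ : s \in enum (agreeing w).
  by rewrite mem_enum inE sS; apply/existsP; exists x; rewrite Es eqxx nx.
by rewrite Es nx.
Qed.

(* A generator moving a point past the level of [x] is the one swapping [x]
   with its successor; a word without it maps the points below to themselves. *)
Lemma agreeing_sub_word u : decomposition S w u -> {subset agreeing w <= u}.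
Proof.
move=> [uS Eu] s sJ; have [sS Es] := agreeingP sJ.
(* If the given point of agreement is lowered, its image is raised and serves instead. *)
have [x ltx Ewx] : exists2 x, (rk x < rk (s x))%N & w x = s x.
  move: sJ; rewrite inE => /andP[_ /existsP[x /andP[nx /eqP Ex]]].
  move: (nx); rewrite -(inj_eq rk_inj).
  case: (ltngtP (rk x) (rk (s x))) => // lt _.
    by exists x.
  exists (s x); rewrite ?S_invol //.
  by rewrite -Ex (near_invol rk_inj rk_lt).
have Esx : rk (s x) = (rk x).+1 by have := S_near sS x; lia.
apply/negPn/negP => s_u.
have low v y : {subset v <= S} -> s \notin v -> (rk y <= rk x)%N ->
    (rk ((\prod_(t <- v) t)%g y) <= rk x)%N.
  elim: v y => [|t v IHv] y vS /=; first by rewrite big_nil perm1.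
  rewrite inE negb_or big_cons permM => /andP[nst s_v] le_y.
  have tS : t \in S by rewrite vS ?mem_head.
  apply: IHv => //; first by move=> t' t'_v; rewrite vS ?inE ?t'_v ?orbT.
  rewrite leqNgt; apply/negP => lt_ty; case/eqP: nst.
  have [t1 t2] := S_near tS y.
  have Ey : y = x by apply: rk_inj; lia.
  have Ety : t x = s x by apply: rk_inj; rewrite -{1}Ey; lia.
  by apply: (S_eq sS tS (x := x)); rewrite // -(inj_eq rk_inj); lia.
have := low u x uS s_u (leqnn _).
by rewrite Eu Ewx leqNgt ltx.
Qed.

End Near.

Lemma free_near w : w \in G -> (is_free S w <-> near rk w).
Proof.
move=> wG; split=> [wF|wN u [uw u_min] s t s_u t_u].
  have [u uR] := ex_reduced wG; have [[uS <-] _] := uR.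
  apply: (near_prod rk_inj rk_lt) (wF _ uR) => s /uS; exact: S_near.
have Jw : decomposition S w (enum (agreeing w)).
  split=> [v|]; last exact: prod_agreeing.
  by rewrite mem_enum inE => /andP[].
have sub : {subset enum (agreeing w) <= u}.
  by move=> v; rewrite mem_enum; apply: agreeing_sub_word.
(* The reduced word [u] contains the duplicate-free word of [agreeing w] and is no longer, so both
   have the same letters. *)
have [_ uE] := uniq_min_size (enum_uniq _) sub (u_min _ Jw).
have uJ v : v \in u -> v \in agreeing w by rewrite -uE mem_enum.
by apply: (agreeing_commute wG wN); apply: uJ.
Qed.

Lemma avoids3_free w : w \in G -> (avoids3 rk w <-> is_free S w).
Proof.
move=> wG; have E1 := avoids3P rk_inj rk_lt w; have E2 := free_near wG.
tauto.
Qed.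

End FoldedTranspositions.

(** * Type A, with transpositions computed on ranks *)

Lemma rk_tperm (T : finType) (rk : T -> nat) (x y z : T) : injective rk ->
  rk (tperm x y z) =
    if rk z == rk x then rk y else if rk z == rk y then rk x else rk z.
Proof.
move=> rk_inj; rewrite !(inj_eq rk_inj).
by case: tpermP => [->|->|/eqP/negPf-> /eqP/negPf->];
  rewrite ?eqxx //; case: eqP => // ->.
Qed.

Lemma freeA n (w : 'S_n) : is_free (simpleA n) w <-> avoids3 (@nat_of_ord n) w.
Proof.
have SP s : s \in simpleA n ->
    exists i j : 'I_n, j = i.+1 :> nat /\ s = tperm i j.
  by case/imset2P => i j _; rewrite inE => /eqP Ej ->; exists i, j.
(* The 0 is a placeholder: an adjacent transposition raises a single point, so the first alternative
   of [S_ascents] always holds. *)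
symmetry; apply: (avoids3_free (G := [group of [set: 'S_n]]) (C := 0));
  rewrite ?inE //.
- exact: val_inj.
- by move=> x; rewrite card_ord.
- exact: subsetT.
- move=> _ /SP[i [j [Ej ->]]] x; rewrite (rk_tperm _ _ _ val_inj) /=.
  by case: eqP; [|case: eqP]; lia.
- move=> x y Ey; exists (tperm x y); last exact: tpermL.
  by apply/imset2P; exists x y; rewrite ?inE ?Ey.
move=> s x z /SP[i [j [Ej ->]]].
rewrite !(rk_tperm _ _ _ val_inj) /= => ltx ltz.
left; apply: val_inj => /=; move: ltx ltz.
by do !case: eqP; lia.
Qed.

(** * Type B, with [[pm n]] ranked from 0 in the order of the integers *)

Section SignedRank.
Variable n : nat.
Implicit Types (x y z : pm n) (w s : {perm pm n}).

Definition signed_rank x : nat := if x.1 then (n.-1 - x.2)%N else (n + x.2)%N.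

Lemma signed_rank_lt x : (signed_rank x < #|{: pm n}|)%N.
Proof.
rewrite card_prod card_bool card_ord; case: x => [[] i];
  rewrite /signed_rank /=;  by have := ltn_ord i; lia.
Qed.

Lemma signed_rank_inj : injective signed_rank.
Proof.
move=> [[] i] [[] j]; rewrite /signed_rank /= => E.
- by congr (_, _); apply: val_inj => /=; have := ltn_ord i; have := ltn_ord j; lia.
- by have := ltn_ord i; lia.
- by have := ltn_ord j; lia.
by congr (_, _); apply: val_inj => /=; lia.
Qed.

Lemma signed_rank_opp x :
  (signed_rank (Defs.opp x) + signed_rank x)%N = (n + n).-1.
Proof. by case: x => [[] i]; rewrite /signed_rank /=; have := ltn_ord i; lia. Qed.

Lemma signed_rank_ltE x y :
  (pmval x < pmval y)%R = (signed_rank x < signed_rank y)%N.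
Proof.
by case: x y => [[] i] [[] j]; rewrite /pmval /signed_rank /=;
  have := ltn_ord i; have := ltn_ord j; lia.
Qed.

(** One formula for both kinds of generators: exchange the ranks [r] and [r.+1], and likewise their
    mirror images under the map taking a rank to [(n + n).-1] minus it. For the sign change [r] is
    [n.-1] and the pair is its own mirror image. *)
Lemma simpleB_rank s : s \in simpleB n ->
  exists2 r, (r.+1 < n + n)%N & forall z,
  signed_rank (s z) =
    if signed_rank z == r then r.+1 else if signed_rank z == r.+1 then r
    else if (signed_rank z + r == (n + n).-1)%N then ((n + n).-1 - r.+1)%N
    else if (signed_rank z + r.+1 == (n + n).-1)%N then ((n + n).-1 - r)%N
    else signed_rank z.
Proof.
case/setUP => [/imsetP[i]|/imset2P[i j _]]; rewrite inE => /eqP Ei ->.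
  exists n.-1 => [|z]; first by have := ltn_ord i; lia.
  rewrite (rk_tperm _ _ _ signed_rank_inj).
  have := signed_rank_lt z; rewrite card_prod card_bool card_ord.
  rewrite /signed_rank /= Ei; move: (signed_rank z) => r; have := ltn_ord i.
  by do !case: eqP; lia.
exists (n + i)%N => [|z]; first by have := ltn_ord j; lia.
rewrite permM !(rk_tperm _ _ _ signed_rank_inj).
rewrite /signed_rank /= Ei -/(signed_rank z); move: (signed_rank z) => r.
have := ltn_ord j; have := ltn_ord i; rewrite Ei.
by do !case: eqP; lia.
Qed.

Lemma simpleB_sub_SB : simpleB n \subset SB n.
Proof.
apply/subsetP => s /simpleB_rank[r r_lt sE]; apply/SBP => x.
apply: signed_rank_inj.
have := signed_rank_opp (s x); have := signed_rank_opp x; rewrite !sE.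
by do !case: eqP; lia.
Qed.

Lemma simpleB_adjacent x y : signed_rank y = (signed_rank x).+1 ->
  exists2 s, s \in simpleB n & s x = y.
Proof.
case: x y => [[] i] [[] j]; rewrite /signed_rank /= => E.
(* Among negatives the order of absolute values is reversed, so here [i] is the successor of [j]. *)
- exists (tperm (pos j) (pos i) * tperm (Defs.opp (pos j)) (Defs.opp (pos i))).
    apply/setUP; right; apply/imset2P; exists j i; rewrite ?inE //.
    by apply/eqP; have := ltn_ord i; have := ltn_ord j; lia.
  by rewrite permM (tpermD (x := pos j)) //; apply: tpermR.
- exists (tperm (pos j) (Defs.opp (pos j))).
    apply/setUP; left; apply/imsetP; exists j; rewrite ?inE //.
    by apply/eqP; have := ltn_ord i; have := ltn_ord j; lia.
  rewrite (_ : i = j); first exact: tpermR.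
  by apply: val_inj => /=; have := ltn_ord i; have := ltn_ord j; lia.
- by have := ltn_ord i; have := ltn_ord j; lia.
exists (tperm (pos i) (pos j) * tperm (Defs.opp (pos i)) (Defs.opp (pos j))).
  apply/setUP; right; apply/imset2P; exists i j; rewrite ?inE //.
  by apply/eqP; lia.
by rewrite permM (tpermL (pos i)) tpermD.
Qed.

Lemma freeB w : w \in SB n -> (is_free (simpleB n) w <-> avoids3 signed_rank w).
Proof.
move=> wG; symmetry.
apply: (avoids3_free (G := SB_group n) (C := (n + n).-1)) => //.
- exact: signed_rank_inj.
- exact: signed_rank_lt.
- exact: simpleB_sub_SB.
- move=> s /simpleB_rank[r r_lt sE] x; rewrite sE.
  have := signed_rank_lt x; rewrite card_prod card_bool card_ord.
  by do !case: eqP; lia.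
- exact: simpleB_adjacent.
move=> s x z sS ltx ltz; have [r r_lt sE] := simpleB_rank sS.
have [ltx1 ltz1] := (signed_rank_lt x, signed_rank_lt z).
rewrite card_prod card_bool card_ord in ltx1 ltz1.
have ox := signed_rank_opp x; have osx := signed_rank_opp (s x).
(* Apart from [x], only the opposite of [s x] can be raised by [s], and it goes to the opposite of
   [x]. *)
have [E|[E1 E2]] : signed_rank z = signed_rank x \/
    signed_rank z = signed_rank (Defs.opp (s x)) /\
    signed_rank (s z) = signed_rank (Defs.opp x).
- move: ltx ltz osx; rewrite !sE; do !case: eqP; lia.
- by left; apply: signed_rank_inj.
right=> v /SBP vopp; rewrite (signed_rank_inj E2) (signed_rank_inj E1) !vopp.
by rewrite !signed_rank_opp.
Qed.

End SignedRank.

(** * Both notions of avoidance as rank avoidance, and persistence *)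

Lemma avoids_allE n (w : 'S_n) :
  avoids_all patterns_231_312_321 w <-> avoids3 (@nat_of_ord n) w.
Proof. by split=> H k p pP; apply: H. Qed.

Lemma globally_avoids_allE n (w : {perm pm n}) :
  globally_avoids_all patterns_231_312_321 w <-> avoids3 (@signed_rank n) w.
Proof.
split=> H k p pP [f f_mono f_iso]; apply: (H k p pP); exists f => a b.
- by rewrite signed_rank_ltE; apply: f_mono.
- by rewrite signed_rank_ltE; apply: f_iso.
- by rewrite -signed_rank_ltE; apply: f_mono.
by rewrite -signed_rank_ltE; apply: f_iso.
Qed.

Theorem theorem5p9 :
  (forall n : nat, (1 <= n)%N ->
     forall w : {perm pm n}, w \in SB n ->
       (globally_avoids_all patterns_231_312_321 w <->
        is_free (simpleB n) w)) /\
  persistent (fun (n : nat) (w : 'S_n) => is_free (simpleA n) w)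
             (fun (n : nat) (w : {perm pm n}) => is_free (simpleB n) w).
Proof.
have B n (w : {perm pm n}) : w \in SB n ->
    (globally_avoids_all patterns_231_312_321 w <-> is_free (simpleB n) w).
  by move=> /freeB wF; rewrite globally_avoids_allE wF.
split=> [n _ w|]; first exact: B.
exists patterns_231_312_321; split=> n _ w; first by rewrite freeA avoids_allE.
by move=> /B ->.
Qed.
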